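(* Let $N\ge1$, let $\Omega\subset\mathbb{R}^N$ be a bounded domain, and let $J$ and $\mathcal{G}$ satisfy the assumptions stated in the context. For every $u_0\in\mathcal{C}_0(\overline\Omega)$ with $u_0\ge0$, the regular solution of $$\begin{cases} u_t(x,t)=\displaystyle\int_{\Omega_J}J(x-y)\,u(y;x,t)\,\mathcal{G}(x,u(y;x,t))\,dy & \text{in }\overline\Omega\times(0,+\infty),\\ u(x,t)=0 & \text{in }(\Omega_J\setminus\overline\Omega)\times(0,+\infty),\\ u(x,0)=u_0(x) & \text{in }\overline\Omega,\end{cases}$$ satisfies $$\lim_{t\to\infty}u(x,t)=0\qquad\text{uniformly in }\overline\Omega.$$
   Context: Notation: $u(y;x,t):=u(y,t)-u(x,t)$, $\Omega_J:=\Omega+\operatorname{supp}(J)$, and $\mathcal{C}_0(\overline\Omega)$ is the space of continuous functions on $\overline\Omega$ vanishing on $\partial\Omega$. Assumptions on $J$: $J:\mathbb{R}^N\to\mathbb{R}$ is a nonnegative radially symmetric function with $J\in\mathcal{C}_c(\mathbb{R}^N)$, $\int_{\mathbb{R}^N}J(z)\,dz=1$ and $C(J):=\int_{\mathbb{R}^N}J(z)z_N^2\,dz<\infty$. Assumptions on $\mathcal{G}$: $\mathcal{G}:\mathbb{R}^N\times\mathbb{R}\to\mathbb{R}$ is a nonnegative Carathéodory function ($\mathcal{G}(\cdot,s)$ measurable for every $s\in\mathbb{R}$, $\mathcal{G}(x,\cdot)$ continuous for a.e. $x\in\mathbb{R}^N$) and there exist constants $\alpha_2\ge\alpha_1>0$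 such that $$\alpha_1\le\frac{\mathcal{G}(x,s)s-\mathcal{G}(x,\sigma)\sigma}{s-\sigma}\le\alpha_2\qquad\text{for all } s,\sigma\in\mathbb{R},\ s\neq\sigma,\ \text{and a.e. }x\in\mathbb{R}^N.$$ Regular solution: a function $u\in\mathcal{C}([0,\infty);\mathcal{C}(\overline\Omega))$, set equal to $0$ on $(\Omega_J\setminus\overline\Omega)\times(0,\infty)$, such that $u(x,t)=\int_0^t\int_{\Omega_J}J(x-y)u(y;x,\tau)\mathcal{G}(x,u(y;x,\tau))\,dy\,d\tau+u_0(x)$ for all $x\in\overline\Omega$, $t>0$, and $\lim_{t\to0^+}\|u(\cdot,t)-u_0\|_{\mathcal{C}(\overline\Omega)}=0$. *)

(* Defs.v *)
From HB Require Import structures.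
From mathcomp Require Import all_boot all_order all_algebra.
From mathcomp Require Import all_classical all_reals all_analysis.
From mathcomp Require Import measurable_realfun.

Set Implicit Arguments.
Unset Strict Implicit.
Unset Printing Implicit Defensive.

Import Order.TTheory GRing.Theory Num.Theory.
Import numFieldNormedType.Exports.

Local Open Scope classical_set_scope.
Local Open Scope ring_scope.

(* R^n is 'rV[R]_n with its library (product) topology. It is measured by the
   product sigma-algebra, which is the Borel one since R is second countable. *)
Definition rV_display : measure_display -> measure_display.
Proof. exact. Qed.

Section measurable_rV.
Context {R : realType} (n : nat).

Let coord (i : 'I_n) (v : 'rV[R]_n) : R := v ord0 i.

Let rV_set0 : g_sigma_preimage coord set0.
Proof. exact: sigma_algebra0. Qed.

Let rV_setC A : g_sigma_preimage coord A -> g_sigma_preimage coord (~` A).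
Proof. exact: sigma_algebraC. Qed.

Let rV_bigcup (F : _^nat) : (forall i, g_sigma_preimage coord (F i)) ->
  g_sigma_preimage coord (\bigcup_i (F i)).
Proof. exact: sigma_algebra_bigcup. Qed.

HB.instance Definition _ := @isMeasurable.Build
  (rV_display default_measure_display) 'rV[R]_n (g_sigma_preimage coord) rV_set0 rV_setC rV_bigcup.

End measurable_rV.

Lemma measurable_coord (R : realType) n (i : 'I_n) :
  measurable_fun [set: 'rV[R]_n] (fun v : 'rV[R]_n => v ord0 i).
Proof.
move=> _ Y mY; rewrite setTI; apply: sub_sigma_algebra => /=.
rewrite -bigcup_seq/=; exists i => /=; first by rewrite mem_index_enum.
by exists Y => //; rewrite setTI.
Qed.

Lemma measurable_fun_coordP (R : realType) d (T : measurableType d) n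
    (f : T -> 'rV[R]_n) :
  (forall i, measurable_fun [set: T] (fun x => f x ord0 i : R)) ->
  measurable_fun [set: T] f.
Proof.
move=> mf.
have : g_sigma_preimage (fun i => (fun v : 'rV[R]_n => v ord0 i) \o f)
    `<=` measurable.
  apply: smallest_sub; first exact: sigma_algebra_measurable.
  case: n => [|n] in f mf *; first by rewrite big_ord0.
  rewrite -bigcup_mkord_ord; apply: bigcup_sub => i Ii.
  by move=> A [B mB <-]; exact: mf.
by rewrite g_sigma_preimage_comp => prefS _ A mA; apply: prefS; exists A.
Qed.

Section lebesgue_rV.
Context (R : realType).

Definition rV_cons n (p : R * 'rV[R]_n) : 'rV[R]_n.+1 :=
  \row_i oapp (p.2 ord0) p.1 (unlift ord0 i).

Definition rV_uncons n (v : 'rV[R]_n.+1) : R * 'rV[R]_n :=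
  (v ord0 ord0, \row_i v ord0 (lift ord0 i)).

Lemma rV_cons0 n (p : R * 'rV[R]_n) : rV_cons p ord0 ord0 = p.1.
Proof. by rewrite mxE unlift_none. Qed.

Lemma rV_consS n (p : R * 'rV[R]_n) i :
  rV_cons p ord0 (lift ord0 i) = p.2 ord0 i.
Proof. by rewrite mxE liftK. Qed.

Lemma rV_consK n : cancel (@rV_cons n) (@rV_uncons n).
Proof.
move=> p; rewrite [RHS]surjective_pairing /rV_uncons rV_cons0; congr pair.
by apply/rowP => i; rewrite mxE rV_consS.
Qed.

Lemma rV_unconsK n : cancel (@rV_uncons n) (@rV_cons n).
Proof.
move=> v; apply/rowP => i; have [j ->|->] := unliftP ord0 i.
  by rewrite rV_consS mxE.
by rewrite rV_cons0.
Qed.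

Lemma measurable_rV_cons n : measurable_fun setT (@rV_cons n).
Proof.
apply: measurable_fun_coordP => i; have [j ->|->] := unliftP ord0 i.
  under eq_fun do rewrite rV_consS.
  exact: (measurableT_comp (measurable_coord j) measurable_snd).
under eq_fun do rewrite rV_cons0.
exact: measurable_fst.
Qed.

Lemma measurable_rV_uncons n : measurable_fun setT (@rV_uncons n).
Proof.
apply: measurable_fun_pair; first exact: measurable_coord.
apply: measurable_fun_coordP => i; under eq_fun do rewrite mxE.
exact: measurable_coord.
Qed.

Lemma lebesgue_rV_sigma_finite n
    (m : {sigma_finite_measure set 'rV[R]_n -> \bar R}) :
  sigma_finite setT (pushforward (@lebesgue_measure R \x m)%E (@rV_cons n)).
Proof.
have /sigma_finiteP[F [TF ndF Foo]] := sigma_finiteT (@lebesgue_measure R).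
have /sigma_finiteP[G [TG ndG Goo]] := sigma_finiteT m.
exists (fun k => @rV_uncons n @^-1` (F k `*` G k)).
  rewrite -preimage_bigcup (_ : \bigcup_k _ = setT) ?preimage_setT//.
  rewrite -setXTT TF TG predeqE => -[x y]; split.
    by move=> [k _ [Fkx Gky]]; split; exists k.
  move=> [[k _ Fkx] [l _ Gly]]; exists (maxn k l) => //; split.
    by move: (x) Fkx; exact/subsetPset/ndF/leq_maxl.
  by move: (y) Gly; exact/subsetPset/ndG/leq_maxr.
move=> k; have [[mF Fkoo] [mG Gkoo]] := (Foo k, Goo k); split.
  rewrite -[X in measurable X]setTI; apply: measurable_rV_uncons => //.
  exact: measurableX.
rewrite /pushforward -comp_preimage (_ : _ \o _ = id); last first.
  by apply/funext => p; exact: rV_consK.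
rewrite preimage_id product_measure1E// lte_mul_pinfty// ge0_fin_numE//.
Qed.

Section succ.
Context n (m : {sigma_finite_measure set 'rV[R]_n -> \bar R}).

Definition lebesgue_rV_succ : set 'rV[R]_n.+1 -> \bar R :=
  pushforward (@lebesgue_measure R \x m)%E (@rV_cons n).

Let lebesgue_rV_succ0 : lebesgue_rV_succ set0 = 0%E.
Proof. by rewrite /lebesgue_rV_succ /pushforward preimage_set0 measure0. Qed.

Let lebesgue_rV_succ_ge0 A : (0 <= lebesgue_rV_succ A)%E.
Proof. by rewrite /lebesgue_rV_succ /pushforward measure_ge0. Qed.

Let lebesgue_rV_succ_sigma_additive : semi_sigma_additive lebesgue_rV_succ.
Proof.
have mcons A : measurable A -> measurable (@rV_cons n @^-1` A).
  by move=> mA; rewrite -[X in measurable X]setTI; exact: measurable_rV_cons.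
move=> F mF tF mUF; rewrite /lebesgue_rV_succ /pushforward preimage_bigcup.
apply: measure_semi_sigma_additive.
- by move=> k; exact: mcons.
- by move=> i j _ _ [p [Fip Fjp]]; apply: tF => //; exists (rV_cons p).
- by rewrite -preimage_bigcup; exact: mcons.
Qed.

HB.instance Definition _ := isMeasure.Build _ _ _ lebesgue_rV_succ
  lebesgue_rV_succ0 lebesgue_rV_succ_ge0 lebesgue_rV_succ_sigma_additive.

HB.instance Definition _ := Measure_isSigmaFinite.Build _ _ _ lebesgue_rV_succ
  (lebesgue_rV_sigma_finite m).

End succ.

Fixpoint lebesgue_rV n : {sigma_finite_measure set 'rV[R]_n -> \bar R} :=
  if n is k.+1 then lebesgue_rV_succ (lebesgue_rV k)
  else \d_(0 : 'rV[R]_0).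

Lemma lebesgue_rV_box n (a b : 'I_n -> R) : (forall i, a i <= b i) ->
  lebesgue_rV n [set v : 'rV[R]_n | forall i, v ord0 i \in `[a i, b i]] =
  (\prod_(i < n) (b i - a i))%:E.
Proof.
elim: n => [|n IHn] in a b *; move=> ab.
  by rewrite /= diracE big_ord0 mem_set// => -[].
rewrite /= /lebesgue_rV_succ /pushforward.
rewrite (_ : _ @^-1` _ = `[a ord0, b ord0] `*`
    [set v : 'rV[R]_n | forall i, v ord0 i \in `[a (lift ord0 i), b (lift ord0 i)]]).
  have mbox : measurable [set v : 'rV[R]_n | forall i,
      v ord0 i \in `[a (lift ord0 i), b (lift ord0 i)]].
    rewrite (_ : mkset _ = \bigcap_(i in [set: 'I_n])
      ((fun v : 'rV[R]_n => v ord0 i) @^-1`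
        `[a (lift ord0 i), b (lift ord0 i)])).
      apply: fin_bigcap_measurable => // i _.
      by rewrite -[X in measurable X]setTI; exact: measurable_coord.
    by apply/seteqP; split => [v vab i _|v vab i]; exact: vab.
  rewrite product_measure1E// IHn// big_ord_recl EFinM; congr (_ * _)%E.
  rewrite [LHS](lebesgue_measure_itv `[a ord0, b ord0])/= lte_fin; case: ltP => // ba.
  by have -> : b ord0 = a ord0; [apply/le_anti; rewrite ba ab|rewrite subrr].
apply/seteqP; split => [[x v] xv|[x v] [/= xab vab] i].
  split => /=; first by have := xv ord0; rewrite rV_cons0.
  by move=> i; have := xv (lift ord0 i); rewrite rV_consS.
by have [j ->|->] := unliftP ord0 i; rewrite (rV_consS, rV_cons0).
Qed.

End lebesgue_rV.
Arguments lebesgue_rV {R} n.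

Section problem.
Context (R : realType) (n : nat).
Local Notation E := 'rV[R]_n.+1.
Local Notation leb := (@lebesgue_rV R n.+1).

Definition boundary (A : set E) : set E := closure A `\` A°.

Definition supp (f : E -> R) : set E := closure [set x | f x != 0].

Definition bounded_domain (Omega : set E) : Prop :=
  [/\ open Omega, connected Omega, Omega !=set0 & bounded_set Omega].

(* The library norm on row vectors is the sup norm. *)
Definition eucl_norm (x : E) : R := Num.sqrt (\sum_i x ord0 i ^+ 2).

Record kernel_assumptions (J : E -> R) : Prop := {
  kernel_ge0 : forall z, 0 <= J z;
  kernel_radial : exists rho : R -> R, forall z, J z = rho (eucl_norm z);
  kernel_continuous : continuous J;
  kernel_compact_supp : compact (supp J);
  kernel_mass : \int[leb]_z J z = 1;
  kernel_moment : (\int[leb]_z (J z * z ord0 ord_max ^+ 2)%:E < +oo)%E }.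

(* Measurability with respect to the Lebesgue, not just the Borel, sets. *)
Definition lebesgue_measurable_fun (f : E -> R) : Prop :=
  measurable_fun [set: g_sigma_algebraType (completed_algebra_gen leb)] f.

Record nonlinearity_assumptions (G : E -> R -> R) : Prop := {
  nonlin_ge0 : forall x s, 0 <= G x s;
  nonlin_measurable : forall s, lebesgue_measurable_fun (G ^~ s);
  nonlin_continuous : {ae leb, forall x, continuous (G x)};
  nonlin_bounds : exists a1 a2 : R, [/\ 0 < a1, a1 <= a2 &
    {ae leb, forall x, forall s r : R, s != r ->
      a1 <= (G x s * s - G x r * r) / (s - r) <= a2}] }.

Definition C0_closure (Omega : set E) (f : E -> R) : Prop :=
  {within closure Omega, continuous f} /\
  (forall x, boundary Omega x -> f x = 0).

Definition Omega_J (Omega : set E) (J : E -> R) : set E :=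
  [set x + z | x in Omega & z in supp J].

Definition nonlocal_op (Omega : set E) (J : E -> R) (G : E -> R -> R)
    (v : E -> R) (x : E) : R :=
  \int[leb]_(y in Omega_J Omega J)
    (J (x - y) * (v y - v x) * G x (v y - v x)).

(* Time comes first: u t x stands for u(x,t), so that u is a curve of
   functions of x. *)
Record regular_solution (Omega : set E) (J : E -> R) (G : E -> R -> R)
    (u0 : E -> R) (u : R -> E -> R) : Prop := {
  sol_space_continuous :
    forall t : R, 0 <= t -> {within closure Omega, continuous (u t)};
  sol_time_continuous : {within `[0, +oo[,
    continuous (u : R -> {uniform` closure Omega -> R})};
  sol_exterior : forall (x : E) (t : R),
    (Omega_J Omega J `\` closure Omega) x -> 0 < t -> u t x = 0;
  sol_integral_eq : forall (x : E) (t : R), closure Omega x -> 0 < t ->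
    u t x = (\int[lebesgue_measure]_(tau in `[0, t])
               nonlocal_op Omega J G (u tau) x) + u0 x;
  sol_initial : {uniform closure Omega, u t @[t --> 0^'+] --> u0} }.

End problem.

(* Main.v *)
Require Import Defs.
From mathcomp Require Import all_boot all_order all_algebra.
From mathcomp Require Import all_classical all_reals all_analysis.
From mathcomp Require Import measurable_realfun.
From mathcomp Require Import ring lra.

(* For almost every x the increments of u at x solve a linear equation
   u_t(x) = int J(x-y) c(x,y,t) (u(y) - u(x)) dy with a1 <= c <= a2. The
   increasing exponential e^(beta y_0) dominates any such kernel: a fixed part
   of the mass of J(x - .) sits on a box where y_0 >= x_0 + delta, and there
   e^(beta (y_0 - x_0)) is as large as we please. Hence psi(y) = A - e^(beta y_0)
   is a positive strict supersolution on the bounded set Omega_J, and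
   K e^(-lam t) psi stays above both u and -u. For x and t such that
   u <= B psi at time t, one gets
   u_t(x) <= - lam B psi(x) + Lam (B psi(x) - u(x)), so that
   e^(Lam t) (K e^(-lam t) psi(x) - u(x,t)) is nondecreasing as long as the
   comparison holds; the resulting gap is uniform in x, so the comparison can
   neither fail at a first time nor be lost on the exceptional null set, whose
   complement is dense. *)

Set Implicit Arguments.
Unset Strict Implicit.
Unset Printing Implicit Defensive.

Import Order.TTheory GRing.Theory Num.Theory.
Import numFieldNormedType.Exports.

Local Open Scope classical_set_scope.
Local Open Scope ring_scope.

(** * Borel sets and Lebesgue measure of row vectors *)

Section borel_rV.
Context {R : realType} {n : nat}.
Implicit Types (x y : 'rV[R]_n) (U : set 'rV[R]_n).

Lemma ball_rVP x e y : 0 < e ->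
  ball x e y <-> forall i, `|x ord0 i - y ord0 i| < e.
Proof.
move=> e0; split=> [[_ xy] i|xy]; first exact: xy.
by split=> // i j; rewrite ord1; exact: xy.
Qed.

Lemma mx_norm_coord_le x i : `|x ord0 i| <= `|x|.
Proof.
rewrite [leRHS]/Num.Def.normr/= mx_normrE.
by apply: (le_trans _ (le_bigmax _ _ (ord0, i))).
Qed.

Lemma measurable_ball_rV x e : measurable (ball x e).
Proof.
have [e0|e0] := leP e 0.
  rewrite (_ : ball x e = set0) ?measurable0//.
  by apply/seteqP; split=> // y [/(le_lt_trans e0)]; rewrite ltxx.
rewrite (_ : ball x e = \bigcap_(i in [set: 'I_n])
    ((fun v : 'rV[R]_n => v ord0 i) @^-1` ball (x ord0 i) e)).
  apply: fin_bigcap_measurable => // i _.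
  rewrite -[X in measurable X]setTI; apply: measurable_coord => //.
  exact: measurable_ball.
by apply/seteqP; split=> [y /(ball_rVP _ _ e0) xy i _|y xy];
  [exact: xy|apply/(ball_rVP _ _ e0) => i; exact: xy].
Qed.

(** The sup-norm balls with rational centre and radius [1/(m+1)] that lie inside [U] are countably
    many and cover it. *)
Lemma open_measurable_rV U : open U -> measurable U.
Proof.
move=> oU.
pose B (p : 'rV[rat]_n * nat) : set 'rV[R]_n :=
  ball (map_mx ratr p.1 : 'rV[R]_n) p.2.+1%:R^-1.
rewrite (_ : U = \bigcup_p (if `[< B p `<=` U >] then B p else set0)).
  apply: countable_bigcupT_measurable => [|p]; first exact: countableP.
  by case: ifPn => _; [exact: measurable_ball_rV|exact: measurable0].
apply/seteqP; split=> [y Uy|y [p _]]; last by case: asboolP => // + By; exact.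
have /nbhs_ballP[e /= e0 yeU] : nbhs y U by exact: open_nbhs_nbhs.
have e20 : 0 < e / 2 by rewrite divr_gt0.
have [m _ /(_ m (leqnn m)) /= me] := near_infty_natSinv_lt (PosNum e20).
set d : R := m.+1%:R^-1 in me; have d0 : 0 < d by rewrite invr_gt0.
have /choice[q yq] (i : 'I_n) :
    exists q : rat, ratr q \in `]y ord0 i - d, y ord0 i + d[.
  by apply: rat_in_itvoo; rewrite ltrBlDr -addrA ltrDl addr_gt0.
have qy (i : 'I_n) : `|ratr (q i) - y ord0 i| < d.
  by have := yq i; rewrite in_itv/= ltr_distl.
have By : B (\row_i q i, m) y.
  by apply/ball_rVP => // i; rewrite !mxE; exact: qy.
exists (\row_i q i, m) => //; case: asboolP => // -[].
move=> z /(ball_rVP _ _ d0) qz; apply: yeU; apply/ball_rVP => // i.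
rewrite (splitr e) -(subrKA (ratr (q i))) (le_lt_trans (ler_normD _ _))// ltrD//.
  by rewrite distrC (lt_trans (qy i)).
by have := qz i; rewrite !mxE => /lt_trans; apply.
Qed.

Lemma continuous_measurable_rV (A : set 'rV[R]_n) (f : 'rV[R]_n -> R) :
  measurable A -> {within A, continuous f} -> measurable_fun A f.
Proof.
move=> mA /continuousP cf.
apply: (measurability _ (measurable_realfun.RGenOpens.measurableE R)).
move=> _ [_ [a [b ->] <-]].
have : open ((f : subspace A -> R) @^-1` `]a, b[%classic).
  exact/cf/interval_open.
move=> /open_subspaceP[V oV VA].
by rewrite setIC -VA; apply: measurableI => //; exact: open_measurable_rV.
Qed.

Lemma measurable_box_rV (a b : 'I_n -> R) :
  measurable [set v : 'rV[R]_n | forall i, v ord0 i \in `[a i, b i]].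
Proof.
rewrite (_ : mkset _ = \bigcap_(i in [set: 'I_n])
    ((fun v : 'rV[R]_n => v ord0 i) @^-1` `[a i, b i]%classic)).
  apply: fin_bigcap_measurable => // i _.
  by rewrite -[X in measurable X]setTI; exact: measurable_coord.
by apply/seteqP; split=> [v vab i _|v vab i]; exact: vab.
Qed.

(** Around any of its points the set contains a closed cube of some side [e > 0], whose volume is
    known. *)
Lemma lebesgue_rV_open_gt0 U : open U -> U !=set0 -> (0 < lebesgue_rV n U)%E.
Proof.
move=> oU [x Ux].
have /nbhs_ballP[e /= e0 xeU] : nbhs x U by exact: open_nbhs_nbhs.
have e2 : 0 < e / 2 by rewrite divr_gt0.
pose a i := x ord0 i - e / 2; pose b i := x ord0 i + e / 2.
apply: (@lt_le_trans _ _
    (lebesgue_rV n [set v : 'rV[R]_n | forall i, v ord0 i \in `[a i, b i]])).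
  rewrite lebesgue_rV_box => [|i]; last first.
    by rewrite lerBlDr -addrA lerDl addr_ge0 ?ltW.
  rewrite lte_fin prodr_gt0// => i _.
  by rewrite subr_gt0 ltrBlDr -addrA ltrDl addr_gt0.
apply: le_measure; rewrite ?inE.
- exact: measurable_box_rV.
- exact: open_measurable_rV.
move=> v vab; apply: xeU; apply/ball_rVP => // i.
have := vab i; rewrite in_itv/= -ler_distl distrC => /le_lt_trans; apply.
by rewrite ltr_pdivrMr// ltr_pMr// ltr1n.
Qed.

Lemma bounded_lebesgue_rV_lty U :
  measurable U -> bounded_set U -> (lebesgue_rV n U < +oo)%E.
Proof.
move=> mU [M [_ UM]]; pose c : R := `|M| + 1.
have Mc : M < c by rewrite (le_lt_trans (ler_norm _))// ltrDl.
have c0 : 0 <= c by rewrite addr_ge0.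
apply: (@le_lt_trans _ _
    (lebesgue_rV n [set v : 'rV[R]_n | forall i, v ord0 i \in `[- c, c]])).
  apply: le_measure; rewrite ?inE//; first exact: measurable_box_rV.
  move=> v Uv i; rewrite in_itv/= -ler_norml.
  exact: le_trans (mx_norm_coord_le _ _) (UM c Mc v Uv).
by rewrite lebesgue_rV_box ?ltry// => i; rewrite ge0_cp.
Qed.

(** Null sets have empty interior, so a property true almost everywhere holds on a dense set. *)
Lemma ae_open_ex (P : 'rV[R]_n -> Prop) U :
  {ae lebesgue_rV n, forall x, P x} -> open U -> U !=set0 ->
  exists2 x, U x & P x.
Proof.
move=> [Z [mZ Z0 PZ]] oU U0; apply: contrapT => noP.
have UZ : U `<=` Z by move=> x Ux; apply: PZ => /= Px; apply: noP; exists x.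
have := lebesgue_rV_open_gt0 oU U0; rewrite ltNge -[X in (_ <= X)%E]Z0.
by rewrite le_measure// inE//; exact: open_measurable_rV.
Qed.

End borel_rV.

(** * Comparison with a decaying multiple of a barrier *)

(** [X] will be the closure of $\Omega$ and [X0] the points of $\Omega$ where the differential
    inequality is available. The [1] in [K + 1] is an initial slack, which the inequality preserves
    up to the factor [expR (- Lam * t)]. *)
Lemma exp_comparison {R : realType} {T : Type} (X X0 : set T) (w w' : R -> T -> R)
    (psi : T -> R) (lam Lam K : R) :
  X0 `<=` X -> 0 <= K ->
  (forall x, X x -> 1 <= psi x) ->
  (forall t : R, 0 <= t -> forall e : R, 0 < e -> exists2 d : R, 0 < d &
    forall s : R, 0 <= s -> `|s - t| < d ->
      forall x, X x -> `|w s x - w t x| <= e) ->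
  (forall t k : R, 0 <= t -> (forall x, X0 x -> w t x <= k * psi x) ->
    forall x, X x -> w t x <= k * psi x) ->
  (forall x (t : R), X0 x -> 0 < t -> is_derive t 1 (w ^~ x) (w' t x)) ->
  (forall x (t B : R), X0 x -> 0 < t -> 0 <= B ->
    (forall y, X y -> w t y <= B * psi y) ->
    w' t x <= - (lam * (B * psi x)) + Lam * (B * psi x - w t x)) ->
  (forall x, X x -> w 0 x <= K * psi x) ->
  forall (t : R) x, 0 <= t -> X x -> w t x <= (K + 1) * expR (- lam * t) * psi x.
Proof.
move=> X0X K0 psi1 cw dense dw lew' w0.
pose B (t : R) := (K + 1) * expR (- lam * t).
have B0 t : 0 <= B t by rewrite mulr_ge0 ?expR_ge0// addr_ge0.
have dB (t : R) : is_derive t 1 B (- (lam * B t)).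
  rewrite /B; apply: is_derive_eq; rewrite /GRing.scale/=; ring.
have cB (t : R) : {for t, continuous B}.
  by apply: differentiable_continuous; apply/derivable1_diffP; apply: ex_derive.
have cwx x (t : R) : X x -> 0 < t -> {for t, continuous (w ^~ x)}.
  move=> Xx t0; apply/cvgrPdist_le => e e0.
  have [d d0 wd] := cw t (ltW t0) e e0.
  (* A radius at most [t] keeps [s] nonnegative, where continuity is assumed. *)
  apply/nbhs_ballP; exists (Num.min d t) => /=; first by rewrite lt_min d0.
  move=> s; rewrite /ball/= lt_min => /andP[std stt].
  rewrite distrC; apply: wd => //; last by rewrite distrC.
  by move: stt; rewrite ltr_distlC subrr => /andP[/ltW].
pose P (t : R) := forall x, X x -> w t x <= B t * psi x.
have gap (t : R) : 0 <= t -> (forall s, 0 <= s <= t -> P s) ->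
    forall x, X x -> w t x <= (B t - expR (- Lam * t)) * psi x.
  move=> t0 Pt; apply: dense => // x X0x; have Xx := X0X _ X0x.
  (* Integrating factor: [h] is nondecreasing as long as the comparison holds, and [h 0] is at least
     [psi x] thanks to the slack. *)
  pose h (s : R) := expR (Lam * s) * (B s * psi x - w s x).
  have h0 : psi x <= h 0.
    rewrite /h /B !mulr0 expR0 mul1r mulr1.
    by have := w0 _ Xx; lra.
  have dh (s : R) : s \in `]0, t[ -> is_derive s 1 h (expR (Lam * s) *
      (Lam * (B s * psi x - w s x) - lam * (B s * psi x) - w' s x)).
    rewrite in_itv/= => /andP[s0 _].
    have dwx := dw x s X0x s0.
    rewrite /h; apply: is_derive_eq; rewrite /GRing.scale/=; ring.
  have : h 0 <= h t.
    apply: (@ger0_derive1_ndecr R h 0 t _ _ _ 0 t (lexx _) t0 (lexx _)).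
    - by move=> s /dh sh; exact: ex_derive.
    - move=> s /[dup] st /dh sh; rewrite derive1E derive_val.
      rewrite mulr_ge0 ?expR_ge0//.
      have /andP[s0 st'] : 0 < s < t by rewrite in_itv/= in st.
      have Ps r : 0 <= r <= s -> P r.
        by move=> /andP[r0 rs]; apply: Pt; rewrite r0 (le_trans rs)// ltW.
      have := lew' x s (B s) X0x s0 (B0 s) (Ps s _).
      rewrite (ltW s0) lexx => /(_ isT).
      lra.
    - apply/subspace_continuousP => s /= /[!in_itv]/= /andP[s0 _].
      rewrite /h; apply: cvgM.
        apply: cvg_within_filter; apply: continuous_comp; last exact: continuous_expR.
        exact: cvgM (cvg_cst _) cvg_id.
      apply: cvgB.
        by apply: cvgM (cvg_cst _); apply: cvg_within_filter; exact: cB.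
      apply/cvgrPdist_le => e e0; have [d d0 wd] := cw s s0 e e0.
      rewrite near_withinE; apply/nbhs_ballP; exists d => //= r.
      rewrite /ball/= distrC => rd /[!in_itv]/= /andP[r0 _].
      by rewrite distrC; exact: wd.
  move=> hh; have : expR (- Lam * t) * psi x <= expR (- Lam * t) * h t.
    by rewrite ler_wpM2l ?expR_ge0// (le_trans h0).
  rewrite /h mulrA -expRD mulNr addNr expR0 mul1r; lra.
have P0 : P 0.
  move=> x Xx; rewrite /B mulr0 expR0 mulr1.
  by have := w0 _ Xx; have := psi1 _ Xx; lra.
suff PT (t : R) : 0 <= t -> P t by move=> t x t0 Xx; exact: PT.
move=> t0; apply: contrapT => nPt.
(* The infimum of [bad] is the first failure time; the contradiction is that no failure can occur
   shortly after it. *)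
pose bad := [set s | 0 <= s /\ ~ P s].
have hbad : has_inf bad by split; [exists t|exists 0 => s []].
have i0 : 0 <= inf bad by apply: lb_le_inf; [exists t|move=> s []].
have ltinf s : 0 <= s -> s < inf bad -> P s.
  move=> s0 si; apply: contrapT => nPs.
  by have := ge_inf hbad.2 (conj s0 nPs : bad s); rewrite leNgt si.
have Pinf : P (inf bad).
  move: i0; rewrite le_eqVlt => /predU1P[<-//|i0] x Xx.
  (* A strict violation at the infimum would persist at slightly earlier times, where the comparison
     holds. *)
  rewrite leNgt; apply/negP => wB.
  have : {for inf bad, continuous (fun s => w s x - B s * psi x)}.
    by apply: cvgB; [exact: cwx|exact: cvgM (cB _) (cvg_cst _)].
  move=> /cvgrPdist_lt/(_ (w (inf bad) x - B (inf bad) * psi x)).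
  rewrite subr_gt0 => /(_ wB)/nbhs_ballP[d /= d0 near_inf].
  pose s := inf bad - Num.min d (inf bad) / 2.
  have m0 : 0 < Num.min d (inf bad) by rewrite lt_min d0.
  have := near_inf s; rewrite /ball/= /s opprB addrCA subrr addr0.
  have md : Num.min d (inf bad) <= d by rewrite ge_min lexx.
  have mi : Num.min d (inf bad) <= inf bad by rewrite ge_min lexx orbT.
  rewrite gtr0_norm ?divr_gt0// -/s => /(_ _)/wrap[|]; first lra.
  have s0 : 0 <= s by rewrite /s; lra.
  have si : s < inf bad by rewrite /s; lra.
  move: (ltinf s s0 si x Xx) => ws; rewrite ltr_norml => /andP[_]; lra.
have := gap _ i0 _; move=> /(_ _)/wrap[|gapi].
  by move=> s /andP[s0]; rewrite le_eqVlt => /predU1P[->//|]; exact: ltinf.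
(* The margin [g * psi x] is split in halves: one absorbs the variation of [w] in time, as [psi] is
   at least 1, the other that of [B]. *)
set g := expR _ in gapi.
have g0 : 0 < g / 2 by rewrite divr_gt0 ?expR_gt0.
have [d d0 wd] := cw _ i0 _ g0.
have /cvgrPdist_le/(_ _ g0)/nbhs_ballP[d' /= d'0 Bd] := cB (inf bad).
have dd : 0 < Num.min d d' by rewrite lt_min d0.
have [s [s0 nPs] si] := inf_adherent dd hbad.
have infs : inf bad <= s by exact: (ge_inf hbad.2).
apply: nPs => x Xx.
have sdd' : s - inf bad < Num.min d d' by rewrite ltrBlDl.
move: sdd'; rewrite lt_min => /andP[sd sd'].
have absE : `|s - inf bad| = s - inf bad by rewrite ger0_norm// subr_ge0.
rewrite -absE in sd sd'.
rewrite distrC in sd'.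
have := Bd s sd'; have := wd s s0 sd x Xx; have := gapi x Xx.
rewrite !ler_norml => H1 /andP[_ H2] /andP[_ H3].
have : (B (inf bad) - B s) * psi x <= g / 2 * psi x.
  by rewrite ler_wpM2r// (le_trans _ (psi1 _ Xx)).
have : g / 2 <= g / 2 * psi x by rewrite ler_peMr ?psi1// ltW.
lra.
Qed.

(** * The kernel and the geometry of [Omega_J] *)

Section kernel.
Context {R : realType} {n : nat}.
Local Notation E := 'rV[R]_n.+1.
Implicit Types (J : E -> R) (Omega : set E).

Lemma kernelN J z : kernel_assumptions J -> J (- z) = J z.
Proof.
move=> hJ; have [rho Jrho] := kernel_radial hJ; rewrite !Jrho /eucl_norm.
by under eq_bigr do rewrite mxE sqrrN.
Qed.

Lemma kernel_bounded J : kernel_assumptions J ->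
  exists2 M, 0 < M & forall z, J z <= M.
Proof.
move=> hJ; have : compact (J @` supp J).
  apply: continuous_compact; last exact: kernel_compact_supp.
  by apply: continuous_subspaceT; exact: kernel_continuous.
move=> /compact_bounded[M [_ JM]]; pose c := `|M| + 1.
have c0 : 0 < c by rewrite ltr_wpDl.
exists c => // z; have [->|Jz] := eqVneq (J z) 0; first exact: ltW.
apply: le_trans (ler_norm _) (JM c _ _ _).
  by rewrite (le_lt_trans (ler_norm _))// ltrDl.
by exists z => //; exact: subset_closure.
Qed.

(** Unit mass gives a point where [J] is positive, radial symmetry rotates it onto the positive
    first axis, and continuity spreads the bound over a box in the half-space where the first
    coordinate is at least [delta]. *)
Lemma kernel_lower_box J : kernel_assumptions J ->
  exists (c : E) (d delta eta : R), [/\ 0 < d, 0 < delta, 0 < eta,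
    delta <= c ord0 ord0 - d &
    forall z : E, (forall i, `|z ord0 i - c ord0 i| <= d) -> eta <= J z].
Proof.
move=> hJ; have J0 := kernel_ge0 hJ.
have [z0 Jz0] : exists z, 0 < J z.
  apply: contrapT => nJ; have J00 z : J z = 0.
    apply/eqP; rewrite eq_le J0 andbT leNgt; apply/negP => Jz.
    by apply: nJ; exists z.
  have := kernel_mass hJ; under eq_Rintegral do rewrite J00.
  by rewrite Rintegral_cst// mul0r => /esym/eqP; rewrite oner_eq0.
have near_J (c : E) : 0 < J c -> exists2 e, 0 < e &
    forall z, ball c e z -> J c / 2 <= J z.
  move=> Jc; have : {for c, continuous J} by exact: (kernel_continuous hJ).
  move=> /cvgrPdist_le/(_ (J c / 2)).
  rewrite divr_gt0// => /(_ isT)/nbhs_ballP[e /= e0 He].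
  by exists e => // z /He/=; rewrite ler_distl => /andP[]; lra.
pose vec (r : R) : E := \row_i (if i == ord0 then r else 0).
have vec_norm r : 0 <= r -> eucl_norm (vec r) = r.
  move=> r0; rewrite /eucl_norm big_ord_recl big1 => [|i _]; last first.
    by rewrite !mxE/= expr0n.
  by rewrite addr0 mxE eqxx sqrtr_sqr ger0_norm.
have [r r0 Jr] : exists2 r, 0 < r & 0 < J (vec r).
  have [rho Jrho] := kernel_radial hJ.
  have en0 : 0 <= eucl_norm z0 by exact: sqrtr_ge0.
  have Jvec : J (vec (eucl_norm z0)) = J z0 by rewrite !Jrho vec_norm.
  (* If the point found is the origin, continuity first moves it along the axis. *)
  move: en0; rewrite le_eqVlt => /predU1P[e0|e0]; last first.
    by exists (eucl_norm z0) => //; rewrite Jvec.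
  have Jv0 : 0 < J (vec 0) by move: Jz0; rewrite -Jvec -e0.
  have [e ep He] := near_J _ Jv0.
  exists (e / 2); first by rewrite divr_gt0.
  apply: lt_le_trans (He _ _); first exact: divr_gt0 Jv0 _.
  apply/ball_rVP => // i; rewrite !mxE; case: ifPn => _.
    by rewrite sub0r normrN gtr0_norm ?divr_gt0// ltr_pdivrMr// ltr_pMr// ltr1n.
  by rewrite subrr normr0.
have [e e0 He] := near_J _ Jr.
have m0 : 0 < Num.min e r by rewrite lt_min e0.
have me : Num.min e r <= e by rewrite ge_min lexx.
have mr : Num.min e r <= r by rewrite ge_min lexx orbT.
(* Half of [Num.min e r] keeps the box inside the ball of radius [e] and its first coordinates at or
   above [r / 2]. *)
exists (vec r), (Num.min e r / 2), (r / 2), (J (vec r) / 2); split.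
- by rewrite divr_gt0.
- by rewrite divr_gt0.
- by rewrite divr_gt0.
- by rewrite mxE eqxx; lra.
- move=> z zc; apply: He; apply/ball_rVP => // i.
  by rewrite distrC (le_lt_trans (zc i))//; lra.
Qed.

Lemma Omega_J_open Omega J : open Omega -> open (Omega_J Omega J).
Proof.
move=> oO; rewrite openE => _ [x Ox [z Jz <-]].
have /nbhs_ballP[e /= e0 xeO] : nbhs x Omega by exact: open_nbhs_nbhs.
apply/nbhs_ballP; exists e => //= y; rewrite -ball_normE/= => xzy.
exists (y - z); last by exists z => //; rewrite subrK.
by apply: xeO; rewrite -ball_normE/= opprB addrA.
Qed.

Lemma Omega_J_bounded Omega J : kernel_assumptions J -> bounded_set Omega ->
  bounded_set (Omega_J Omega J).
Proof.
move=> hJ [M1 [_ O1]].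
have [M2 [_ O2]] := compact_bounded (kernel_compact_supp hJ).
exists (`|M1| + 1 + (`|M2| + 1)); split; first by rewrite num_real.
move=> M ltM _ [x Ox [z Jz <-]] /=.
rewrite (le_trans (ler_normD _ _))// (le_trans _ (ltW ltM))// lerD//.
  by apply: O1 => //; rewrite (le_lt_trans (ler_norm _))// ltrDl.
by apply: O2 => //; rewrite (le_lt_trans (ler_norm _))// ltrDl.
Qed.

Lemma closure_bounded Omega : bounded_set Omega -> bounded_set (closure Omega).
Proof.
move=> [M [_ OM]]; exists (`|M| + 2); split; first by rewrite num_real.
move=> M' ltM x clx /=; have [y [Oy xy]] := clx _ (nbhsx_ballx x 1 ltr01).
have yM : `|y| <= `|M| + 1.
  by apply: OM => //; rewrite (le_lt_trans (ler_norm _))// ltrDl.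
move: xy; rewrite -ball_normE/= => xy.
have := ler_normD (x - y) y; rewrite subrK; lra.
Qed.

Lemma closure_compact Omega : bounded_set Omega -> compact (closure Omega).
Proof.
move=> bO; apply: bounded_closed_compact; first exact: closure_bounded.
exact: closed_closure.
Qed.

Lemma Omega_J_neq0 Omega J x y : kernel_assumptions J -> Omega x ->
  J (x - y) != 0 -> Omega_J Omega J y.
Proof.
move=> hJ Ox Jxy; exists x => //; exists (y - x); last by rewrite addrC subrK.
by apply: subset_closure; rewrite /= -(kernelN _ hJ) opprB.
Qed.

End kernel.

(** * Ellipticity of the nonlinearity at a fixed point *)

(** The conditions granted at almost every [x], isolated for one function [g], which stands for
    [G x]. *)
Definition elliptic_at {R : realType} (a1 a2 : R) (g : R -> R) : Prop :=
  continuous g /\ forall s r : R, s != r ->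
    a1 <= (g s * s - g r * r) / (s - r) <= a2.

Section elliptic.
Context {R : realType} (a1 a2 : R) (g : R -> R).
Hypotheses (a1_gt0 : 0 < a1) (a12 : a1 <= a2) (ell : elliptic_at a1 a2 g).

Lemma elliptic_lipschitz s r : `|s * g s - r * g r| <= a2 * `|s - r|.
Proof.
have [->|sr] := eqVneq s r; first by rewrite !subrr normr0 mulr0.
have sr0 : s - r != 0 by rewrite subr_eq0.
have /andP[l u] := ell.2 s r sr.
rewrite -ler_pdivrMr ?normr_gt0// -normrV ?unitfE// -normrM.
by rewrite ger0_norm ![_ * g _]mulrC// (le_trans (ltW a1_gt0)).
Qed.

(** The difference quotient between [s] and 0 is [g s] itself; at [s = 0] any coefficient will
    do. *)
Lemma elliptic_coef s : exists2 c, a1 <= c <= a2 & s * g s = c * s.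
Proof.
have [->|s0] := eqVneq s 0; first by exists a1; rewrite ?lexx// mul0r mulr0.
exists (g s); last exact: mulrC.
by have := ell.2 s 0 s0; rewrite mulr0 !subr0 mulfK.
Qed.

End elliptic.

(** * Integrability and continuity of the nonlocal operator *)

Section nonlocal.
Context {R : realType} {n : nat}.
Local Notation E := 'rV[R]_n.+1.
Local Notation leb := (@lebesgue_rV R n.+1).
Context (Omega : set E) (J : E -> R) (G : E -> R -> R) (a1 a2 M : R) (x : E).
Hypotheses (oO : open Omega) (bO : bounded_set Omega) (hJ : kernel_assumptions J).
Hypotheses (JM : forall z, J z <= M) (a1_gt0 : 0 < a1) (a12 : a1 <= a2).
Hypotheses (Ox : Omega x) (ell : elliptic_at a1 a2 (G x)).
Local Notation OJ := (Omega_J Omega J).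
Local Notation V := (fine (leb OJ)).

(** Models the solution at a positive time; values off both [Omega_J] and the closure of $\Omega$
    are left free. *)
Definition admissible (v : E -> R) : Prop :=
  {within closure Omega, continuous v} /\
  (forall y, (OJ `\` closure Omega) y -> v y = 0).

Lemma measurable_Omega_J : measurable OJ.
Proof. by apply: open_measurable_rV; exact: Omega_J_open. Qed.

Lemma lebesgue_Omega_J_lty : (leb OJ < +oo)%E.
Proof.
exact: bounded_lebesgue_rV_lty measurable_Omega_J (Omega_J_bounded hJ bO).
Qed.

Lemma admissible_measurable v : admissible v -> measurable_fun OJ v.
Proof.
move=> [cv v0]; have mcl : measurable (closure Omega).
  rewrite -[closure _]setCK; apply: measurableC; apply: open_measurable_rV.
  by apply: closed_openC; exact: closed_closure.
apply: (@measurable_funS _ _ _ _ (closure Omega `|` (OJ `\` closure Omega))).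
- by apply: measurableU => //; apply: measurableD => //; exact: measurable_Omega_J.
- by move=> y Oy; have [cy|ncy] := pselect (closure Omega y); [left|right].
apply/measurable_funU => //.
  by apply: measurableD => //; exact: measurable_Omega_J.
split; first exact: continuous_measurable_rV.
have := @measurable_cst _ _ _ _ (OJ `\` closure Omega) (0 : R).
by apply: eq_measurable_fun => y /[!inE] /v0.
Qed.

Lemma admissible_bounded v : admissible v ->
  exists2 C, 0 <= C & forall y, (OJ `|` closure Omega) y -> `|v y| <= C.
Proof.
move=> [cv v0]; have : compact (v @` closure Omega).
  by apply: continuous_compact => //; exact: closure_compact.
move=> /compact_bounded[C [_ vC]]; exists (`|C| + 1) => // y.
have [cy _|ncy] := pselect (closure Omega y).
  by apply: vC; [rewrite (le_lt_trans (ler_norm _))// ltrDl|exists y].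
by move=> [Oy|//]; rewrite v0// normr0.
Qed.

Lemma nonlocal_integrable v : admissible v ->
  leb.-integrable OJ (EFin \o (fun y =>
    J (x - y) * (v y - v x) * G x (v y - v x))).
Proof.
move=> av; have [C C0 vC] := admissible_bounded av.
have mv := admissible_measurable av.
have mB : measurable_fun OJ (fun y => v y - v x).
  by apply: measurable_funB => //; exact: measurable_cst.
apply: measurable_bounded_integrable.
- exact: measurable_Omega_J.
- exact: lebesgue_Omega_J_lty.
- apply: measurable_funM; first apply: measurable_funM => //.
    apply: continuous_measurable_rV; first exact: measurable_Omega_J.
    apply: continuous_subspaceT => y; apply: continuous_comp; last first.
      exact: (kernel_continuous hJ).
    exact: (@cvgB R E _ (nbhs y) _ (fun=> x) id x y (cvg_cst _) cvg_id).
  apply: (measurableT_comp _ mB); apply: continuous_measurable_fun.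
  exact: ell.1.
exists (M * (a2 * (C + C))); split; first by rewrite num_real.
move=> K ltK y Oy /=; rewrite (le_trans _ (ltW ltK))//.
rewrite -mulrA normrM ler_pM//.
  by rewrite ger0_norm// (kernel_ge0 hJ).
have := elliptic_lipschitz a1_gt0 ell (v y - v x) 0.
rewrite mul0r !subr0 => /le_trans; apply.
rewrite ler_pM2l ?(lt_le_trans a1_gt0)// (le_trans (ler_normB _ _))// lerD//.
  by apply: vC; left.
by apply: vC; right; exact: subset_closure.
Qed.

(** The values at [y] and at [x] each differ by at most [e], whence [e + e]; on the rest of
    [Omega_J] both functions vanish. This serves for continuity in time of the operator along the
    solution. *)
Lemma nonlocal_lipschitz v w e : admissible v -> admissible w ->
  (forall y, closure Omega y -> `|v y - w y| <= e) ->
  `|nonlocal_op Omega J G v x - nonlocal_op Omega J G w x|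
     <= M * (a2 * (e + e)) * V.
Proof.
move=> av aw vwe.
have iv := nonlocal_integrable av; have iw := nonlocal_integrable aw.
have mO := measurable_Omega_J.
have vx := vwe _ (subset_closure Ox).
have e0 : 0 <= e by exact: le_trans vx.
rewrite /nonlocal_op -RintegralB//.
rewrite -Rintegral_cst//.
have iB := integrableB mO iv iw.
apply: le_trans (le_normr_Rintegral mO _) _; first exact: iB.
apply: le_Rintegral => //.
- exact: integrable_norm iB.
- apply: measurable_bounded_integrable => //; first exact: lebesgue_Omega_J_lty.
  exact: bounded_cst.
move=> y Oy; rewrite -!mulrA -mulrBr normrM ler_pM//.
  by rewrite ger0_norm// (kernel_ge0 hJ).
apply: le_trans (elliptic_lipschitz a1_gt0 ell _ _) _.
rewrite ler_pM2l ?(lt_le_trans a1_gt0)//.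
rewrite (_ : _ - _ = (v y - w y) - (v x - w x)); last by ring.
rewrite (le_trans (ler_normB _ _))// lerD//.
have [cy|ncy] := pselect (closure Omega y); first exact: vwe.
by rewrite av.2// aw.2// subrr normr0.
Qed.

End nonlocal.

(** * The exponential barrier *)

(** The pointwise bound integrated in [barrier]: [j] is [J (x - y)], [s] the signed increment of the
    function, [q] that of [psi], [p] the gap at [x], [e] the exponential at [x], and [b] tells
    whether [y] lies in the favourable box. The product [j * c] is at most [a2 * M] everywhere and
    at least [a1 * eta] in the box. *)
Lemma weighted_increment_le {R : realType}
    (j M a1 a2 c eta B e F p q s : R) (b : bool) :
  0 <= j <= M -> 0 < a1 -> a1 <= c <= a2 -> (b -> eta <= j) -> 0 <= eta ->
  0 <= B -> 0 <= e -> 0 <= F -> 0 <= p ->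
  s <= B * q + p -> q <= e * (1 - F * b%:R) ->
  j * (c * s) <=
    B * e * (a2 * M) + a2 * M * p - B * e * (a1 * eta * F) * b%:R.
Proof.
move=> /andP[j0 jM] a1_gt0 /andP[a1c ca2] bj eta0 B0 e0 F0 p0 sq qe.
have c0 : 0 <= c by lra.
have jc0 : 0 <= j * c by rewrite mulr_ge0.
have jcM : j * c <= a2 * M by rewrite mulrC ler_pM.
have jcb : a1 * eta * b%:R <= j * c * b%:R.
  case: b bj {qe} => [/(_ isT) etaj|_]; last by rewrite !mulr0.
  by rewrite !mulr1 mulrC ler_pM// ltW.
have s_le : s <= B * (e * (1 - F * b%:R)) + p.
  by rewrite (le_trans sq)// lerD2r ler_wpM2l.
have BeF : 0 <= B * e * F by rewrite !mulr_ge0.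
have Bep : 0 <= B * e + p by rewrite addr_ge0// mulr_ge0.
rewrite mulrA (le_trans (ler_wpM2l jc0 s_le))//.
have := ler_wpM2l BeF jcb; have := ler_wpM2r Bep jcM; lra.
Qed.

Section barrier.
Context {R : realType} {n : nat}.
Local Notation E := 'rV[R]_n.+1.
Local Notation leb := (@lebesgue_rV R n.+1).

(** The constants are chosen before [G], [x] and [v], so the estimate is uniform in them; [sigma]
    equal to 1 or -1 covers bounds from above and from below. *)
Lemma barrier (Omega : set E) (J : E -> R) (a1 a2 : R) :
  open Omega -> bounded_set Omega -> kernel_assumptions J ->
  0 < a1 -> a1 <= a2 ->
  exists (psi : E -> R) (A lam Lam : R), [/\ 0 < lam, continuous psi,
    forall y, closure Omega y -> 1 <= psi y <= A &
    forall (G : E -> R -> R) x v (B sigma : R),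
      Omega x -> elliptic_at a1 a2 (G x) -> admissible Omega J v -> 0 <= B ->
      (forall y, closure Omega y -> sigma * v y <= B * psi y) ->
      sigma * nonlocal_op Omega J G v x <=
        - (lam * (B * psi x)) + Lam * (B * psi x - sigma * v x)].
Proof.
move=> oO bO hJ a1_gt0 a12.
have [M M0 JM] := kernel_bounded hJ.
have [c [d [delta [eta [d0 delta0 eta0 cdelta Jeta]]]]] := kernel_lower_box hJ.
pose V : R := fine (leb (Omega_J Omega J)).
have V0 : 0 <= V by rewrite fine_ge0.
pose mu : R := \prod_(i < n.+1) (d + d).
have mu0 : 0 < mu by rewrite prodr_gt0// => i _; rewrite addr_gt0.
have ca : 0 < a1 * eta * mu by rewrite !mulr_gt0.
(* [F] makes the gain in the box, [a1 * eta * F * mu], exceed the worst loss [a2 * M * V] by more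
   than 1. *)
pose F := 1 + (a2 * M * V + 1) / (a1 * eta * mu).
have a2_gt0 : 0 < a2 by exact: lt_le_trans a12.
have F1 : 1 <= F.
  by rewrite lerDl divr_ge0 ?(ltW ca)// addr_ge0// !mulr_ge0// ltW.
have FE : a1 * eta * F * mu = a1 * eta * mu + (a2 * M * V + 1).
  rewrite /F; field; rewrite !gt_eqF//.
have F_gt0 : 0 < F by lra.
(* Across a distance [delta] the exponential grows by the factor [F]. *)
pose beta := ln F / delta.
have beta0 : 0 <= beta by rewrite divr_ge0 ?ln_ge0// ltW.
have betaF : expR (beta * delta) = F.
  by rewrite /beta mulfVK ?gt_eqF// lnK// posrE.
have [Rb Rb0 yRb] : exists2 Rb : R, 0 <= Rb &
    forall y : E, (Omega_J Omega J `|` closure Omega) y -> `|y ord0 ord0| <= Rb.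
  have [M1 [_ H1]] := Omega_J_bounded hJ bO.
  have [M2 [_ H2]] := closure_bounded bO.
  exists (`|M1| + 1 + (`|M2| + 1)); first by rewrite !addr_ge0.
  move=> y [Jy|cy]; apply: le_trans (mx_norm_coord_le _ _) _.
    apply: H1 => //; have := ler_norm M1; have := normr_ge0 M2; lra.
  apply: H2 => //; have := ler_norm M2; have := normr_ge0 M1; lra.
pose A : R := 1 + expR (beta * Rb).
have A0 : 0 < A by rewrite addr_gt0// expR_gt0.
pose psi (y : E) : R := A - expR (beta * y ord0 ord0).
have psi1 y : (Omega_J Omega J `|` closure Omega) y -> 1 <= psi y.
  move=> /yRb/ler_normlW yR; rewrite /psi /A lerBrDr lerD2l ler_expR.
  by rewrite ler_wpM2l.
have psiA y : psi y <= A by rewrite /psi gerBl expR_ge0.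
exists psi, A, (expR (- (beta * Rb)) / A), (a2 * M * V); split.
- by rewrite divr_gt0// expR_gt0.
- move=> y; apply: (@cvgB R R^o _ (nbhs y) _ (fun=> A)
    (fun z : E => expR (beta * z ord0 ord0)) A _ (cvg_cst _)).
  apply: (@continuous_comp _ _ _ (fun z : E => beta * z ord0 ord0) expR); last first.
    exact: continuous_expR.
  exact: (@cvgM R E (nbhs y) _ (fun=> beta) (fun z => z ord0 ord0) beta _
    (cvg_cst _) (@coord_continuous _ _ _ ord0 ord0 y)).
- by move=> y cy; rewrite psiA psi1//; right.
move=> G x v B sigma Ox ell av B0 vB.
have clx := subset_closure Ox.
(* [D] is the box of [kernel_lower_box] translated by [x]; it lies in [Omega_J] because [J (x - y)]
   is positive there, so its whole volume [mu] counts. *)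
pose D := [set y : E | forall i, y ord0 i \in
  `[x ord0 i + c ord0 i - d, x ord0 i + c ord0 i + d]].
have Dz y : D y -> eta <= J (x - y).
  move=> Dy; rewrite -(kernelN _ hJ) opprB; apply: Jeta => i; rewrite !mxE.
  have := Dy i; rewrite in_itv/= => H; rewrite ler_norml; lra.
have DO : D `<=` Omega_J Omega J.
  move=> y Dy; apply: (Omega_J_neq0 hJ Ox).
  by rewrite gt_eqF// (lt_le_trans eta0)// Dz.
have mD : measurable D by exact: measurable_box_rV.
have mO := measurable_Omega_J J oO.
have Oty := lebesgue_Omega_J_lty oO bO hJ.
have muE : leb D = mu%:E.
  rewrite lebesgue_rV_box => [|i]; last by lra.
  by congr EFin; apply: eq_bigr => i _; ring.
have ik := nonlocal_integrable oO bO hJ JM a1_gt0 a12 Ox ell av.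
pose e := expR (beta * x ord0 ord0).
have e0 : 0 <= e by exact: expR_ge0.
pose p := B * psi x - sigma * v x.
have p0 : 0 <= p by rewrite subr_ge0 vB.
pose P := B * e * (a2 * M) + a2 * M * p.
pose Q := B * e * (a1 * eta * F).
have i1 (k : R) : leb.-integrable (Omega_J Omega J) (EFin \o (fun=> k)).
  by apply: measurable_bounded_integrable => //; exact: bounded_cst.
have iD : leb.-integrable (Omega_J Omega J) (EFin \o \1_D).
  apply: measurable_bounded_integrable => //.
  exists 1; split=> // K K1 y _ /=; rewrite indicE.
  by rewrite (le_trans _ (ltW K1))//; case: (_ \in _); rewrite ?normr1 ?normr0.
have iQD : leb.-integrable (Omega_J Omega J) (EFin \o (fun y => Q * \1_D y)).
  exact: (integrableZl mO Q iD).
have D1 : \int[leb]_(y in Omega_J Omega J) \1_D y = mu.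
  rewrite /Rintegral integral_indic// setIidl//; exact: (congr1 fine muE).
have : sigma * nonlocal_op Omega J G v x <= P * V - Q * mu.
  rewrite /nonlocal_op -RintegralZl// -D1 -RintegralZl// -Rintegral_cst//.
  rewrite -RintegralB//.
  apply: le_Rintegral => //.
  - exact: (integrableZl mO sigma ik).
  - exact: (integrableB mO (i1 P) iQD).
  move=> y Oy; have [k a12k kE] := elliptic_coef a12 ell (v y - v x).
  rewrite -mulrA kE mulrCA (mulrCA sigma).
  rewrite indicE; apply: (weighted_increment_le (q := psi y - psi x)) => //.
  - by rewrite JM (kernel_ge0 hJ).
  - by rewrite inE; exact: Dz.
  - exact: ltW.
  - exact: ltW.
  (* Off the closure [v] vanishes while [psi] is positive, so the comparison extends to all of
     [Omega_J]. *)
  - rewrite /p; have : sigma * v y <= B * psi y; last lra.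
    have [cy|ncy] := pselect (closure Omega y); first exact: vB.
    by rewrite av.2// mulr0 mulr_ge0// (le_trans ler01)// psi1//; left.
  - have -> : psi y - psi x = e - expR (beta * y ord0 ord0).
      by rewrite /psi /e; ring.
    (* On [D] the first coordinate exceeds that of [x] by at least [delta]; elsewhere the
       exponential at [y] is merely dropped. *)
    case: (boolP (y \in D)) => [/set_mem Dy|_].
      rewrite mulr1 mulrBr mulr1 lerB// -betaF -expRD ler_expR -mulrDr.
      rewrite ler_wpM2l//; have := Dy ord0; rewrite in_itv/=; lra.
    by rewrite mulr0 subr0 mulr1 gerBl expR_ge0.
move=> /le_trans; apply.
(* Since [psi x] is at most [A] and the first coordinate of [x] at least [- Rb], the surplus [B * e]
   pays for the decay term. *)
have lamE : expR (- (beta * Rb)) / A * psi x <= e.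
  apply: (@le_trans _ _ (expR (- (beta * Rb)))).
    by rewrite mulrAC ler_pdivrMr// ler_wpM2l// expR_ge0.
  rewrite ler_expR -mulrN ler_wpM2l//.
  by have := yRb x (or_intror clx); rewrite ler_norml => /andP[].
have := ler_wpM2l B0 lamE.
have Bca : 0 <= B * e * (a1 * eta * mu) by rewrite !mulr_ge0// ltW.
rewrite (_ : Q * mu = B * e * (a1 * eta * mu + (a2 * M * V + 1))); last first.
  by rewrite /Q -mulrA FE.
rewrite /P /p; lra.
Qed.

End barrier.

(** * Passing to the closure, and differentiating in time *)

(** Positivity at one point would spread, by continuity, to a nonempty open piece of [Omega], which
    meets the set where [P] holds. *)
Lemma closure_le0_ae {R : realType} {n : nat} (Omega : set 'rV[R]_n)
    (P : 'rV[R]_n -> Prop) (f : 'rV[R]_n -> R) :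
  open Omega -> {ae lebesgue_rV n, forall x, P x} ->
  {within closure Omega, continuous f} ->
  (forall x, Omega x -> P x -> f x <= 0) ->
  forall x, closure Omega x -> f x <= 0.
Proof.
move=> oO aeP cf fP x clx; rewrite leNgt; apply/negP => fx0.
have /subspace_continuousP/(_ x clx)/cvgrPdist_lt/(_ _ fx0) := cf.
rewrite near_withinE => /nbhs_ballP[e /= e0 xef].
have [y [Oy xey]] := clx _ (nbhsx_ballx x e e0).
have oU : open (ball x e `&` Omega).
  by apply: openI => //; exact: ball_open.
have [z [xez Oz] Pz] := ae_open_ex aeP oU (ex_intro _ y (conj xey Oy)).
have := xef z xez (subset_closure Oz); have := fP z Oz Pz.
by rewrite /from_subspace ltr_norml => fz /andP[_]; lra.
Qed.

(** The fundamental theorem of calculus for [F], which extends [f] continuously from the positive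
    times. *)
Lemma integral_is_derive {R : realType} (F f g : R -> R) (c t : R) :
  continuous F -> (forall s, 0 < s -> F s = f s) ->
  (forall s, 0 < s -> g s = \int[lebesgue_measure]_(r in `[0, s]) f r + c) ->
  0 < t -> is_derive t 1 g (f t).
Proof.
move=> cF FE gE t0.
have iF s : lebesgue_measure.-integrable `[0, s] (EFin \o F).
  apply: continuous_compact_integrable; first exact: segment_compact.
  exact: continuous_subspaceT.
have t1 : t < t + 1 by rewrite ltrDl.
have [dH HF] := continuous_FTC1_closed t1 (iF _) t0 (cF t).
set H := (fun _ => _) in dH HF.
have uE s : 0 < s -> H s + c = g s.
  move=> s0; rewrite gE//; congr (_ + _).
  (* Dropping the endpoint 0, a null set, leaves only times at which [F] and [f] agree. *)
  have iF' : lebesgue_measure.-integrable `]0, s] (EFin \o F).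
    by apply: integrableS (iF s) => //; exact: subset_itv_oc_cc.
  rewrite /H -Rintegral_itv_obnd_cbnd// -Rintegral_itv_obnd_cbnd; last first.
    apply: eq_integrable iF' => // r; rewrite inE/= in_itv/= => /andP[r0 _].
    by rewrite FE.
  by apply: eq_Rintegral => r; rewrite inE/= in_itv/= => /andP[r0 _]; rewrite FE.
have dHF : is_derive t 1 (fun s => H s + c) (F t + 0).
  by apply: is_deriveD; rewrite -HF derive1E; exact: derivableP.
have <- : F t + 0 = f t by rewrite addr0 FE.
apply: near_eq_is_derive dHF.
by near=> s; apply: uE; near: s; exact: lt_nbhsr.
Unshelve. all: by end_near. Qed.

Section solution.
Context {R : realType} {n : nat}.
Local Notation E := 'rV[R]_n.+1.
Context (Omega : set E) (J : E -> R) (G : E -> R -> R).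
Context (u0 : E -> R) (u : R -> E -> R).
Hypothesis hu : regular_solution Omega J G u0 u.

Lemma solution_uniform_continuous t : 0 <= t -> forall e, 0 < e ->
  exists2 d : R, 0 < d & forall s : R, 0 <= s -> `|s - t| < d ->
    forall x, closure Omega x -> `|u s x - u t x| <= e.
Proof.
move=> t0 e e0; have /subspace_continuousP/(_ t) := sol_time_continuous hu.
rewrite /= in_itv/= t0 => /(_ isT) cu.
have : nbhs (u t : {uniform` closure Omega -> R})
    [set h : {uniform` closure Omega -> R} |
      forall x, closure Omega x -> `|h x - u t x| <= e].
  apply/uniform_nbhs; exists [set xy : R * R | ball xy.1 e xy.2]; split.
    exact: (entourage_ball _ (PosNum e0)).
  by move=> h /= uh x /uh; rewrite /ball/= distrC => /ltW.
move=> /cu; rewrite /= nbhs_simpl/= => /nbhs_ballP[d /= d0 H].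
exists d => // s s0 st; apply: H; last by rewrite /= in_itv/= s0.
by rewrite /ball/= distrC.
Qed.

Lemma solution_admissible t : 0 < t -> admissible Omega J (u t).
Proof.
move=> t0; split; first by apply: (sol_space_continuous hu); exact: ltW.
by move=> y Oy; exact: (sol_exterior hu).
Qed.

(** By [nonlocal_lipschitz] the time integrand is continuous at positive times, so the integral
    equation can be differentiated. *)
Lemma solution_is_derive (a1 a2 t : R) (x : E) :
  open Omega -> bounded_set Omega -> kernel_assumptions J -> 0 < a1 -> a1 <= a2 ->
  Omega x -> elliptic_at a1 a2 (G x) -> 0 < t ->
  is_derive t 1 (u ^~ x) (nonlocal_op Omega J G (u t) x).
Proof.
move=> oO bO hJ a1_gt0 a12 Ox ell t0.
have [M M0 JM] := kernel_bounded hJ; have clx := subset_closure Ox.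
(* At time 0 nothing is known about u outside the closure of Omega, hence the
   cut-off; freezing negative times makes F continuous on the whole line. *)
pose v (s : R) (y : E) : R := if y \in closure Omega then u (Num.max s 0) y else 0.
pose F (s : R) : R := nonlocal_op Omega J G (v s) x.
have av s : admissible Omega J (v s).
  split; last by move=> y [_ ncy]; rewrite /v memNset.
  apply: (@subspace_eq_continuous _ _ _ (u (Num.max s 0))).
    by move=> y cy; rewrite /v /from_subspace cy.
  by apply: (sol_space_continuous hu); rewrite le_max lexx orbT.
have FE s : 0 < s -> F s = nonlocal_op Omega J G (u s) x.
  move=> s0; have vu y : (Omega_J Omega J `|` closure Omega) y -> v s y = u s y.
    rewrite /v max_l ?ltW//; case: ifPn => // /negP ncy [Oy|/mem_set//].
    by rewrite (sol_exterior hu)//; split=> // /mem_set.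
  apply: eq_Rintegral => y /set_mem Oy; rewrite !vu//; first by right.
  by left.
have cF : continuous F.
  move=> s; apply/cvgrPdist_le => e e0.
  (* [C - 1] is the Lipschitz constant of the operator, so a variation [e / C] changes [F] by at
     most [e]; the added 1 keeps [C] positive. *)
  pose C := M * (a2 * 2) * fine (lebesgue_rV n.+1 (Omega_J Omega J)) + 1.
  have C0 : 0 < C.
    by rewrite ltr_wpDl// !mulr_ge0 ?fine_ge0// ltW// (lt_le_trans a1_gt0).
  have s0 : 0 <= Num.max s 0 by rewrite le_max lexx orbT.
  have [d d0 ud] := solution_uniform_continuous s0 (divr_gt0 e0 C0).
  apply/nbhs_ballP; exists d => //= r; rewrite /ball/= distrC => rs.
  rewrite distrC; apply: le_trans (nonlocal_lipschitz oO bO hJ JM a1_gt0 a12 Ox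
    ell (av r) (av s) (e := e / C) _) _.
    move=> y cy; rewrite /v mem_set//; apply: ud => //.
      by rewrite le_max lexx orbT.
    apply: le_lt_trans rs; rewrite /Num.max.
    have := ler_norm (r - s); have := ler_norm (s - r); rewrite (distrC s).
    by case: ltP => ?; case: ltP => ?; rewrite ?subrr ?normr0//
      => ? ?; rewrite ler_norml; apply/andP; split; lra.
  rewrite (_ : _ * _ = (C - 1) * (e / C)); last by rewrite /C; ring.
  by rewrite mulrBl mulrCA divff ?gt_eqF// mulr1 mul1r gerBl divr_ge0// ltW.
exact: (integral_is_derive (g := u ^~ x) cF FE
  (fun s s0 => sol_integral_eq hu clx s0) t0).
Qed.

End solution.

(** * Exponential decay and uniform convergence *)

(** The comparison is applied to both [u] and its opposite, and [psi] is bounded by [A] on the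
    closure. *)
Lemma solution_exp_decay {R : realType} {n : nat} (Omega : set 'rV[R]_n.+1)
    (J : 'rV[R]_n.+1 -> R) (G : 'rV[R]_n.+1 -> R -> R)
    (u0 : 'rV[R]_n.+1 -> R) (u : R -> 'rV[R]_n.+1 -> R) :
  open Omega -> bounded_set Omega -> kernel_assumptions J ->
  nonlinearity_assumptions G -> regular_solution Omega J G u0 u ->
  exists C lam : R, [/\ 0 < C, 0 < lam & forall t x, 0 <= t -> closure Omega x ->
    `|u t x| <= C * expR (- lam * t)].
Proof.
move=> oO bO hJ hG hu; have [a1 [a2 [a1_gt0 a12 aeG]]] := nonlin_bounds hG.
have [psi [A [lam [Lam [lam0 cpsi psiA lepsi]]]]] := barrier oO bO hJ a1_gt0 a12.
have psi1 x : closure Omega x -> 1 <= psi x by move=> /psiA/andP[].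
have ae_ell : {ae lebesgue_rV n.+1, forall x, elliptic_at a1 a2 (G x)}.
  by apply: filterS2 (nonlin_continuous hG) aeG => x cGx Gx; split.
have [K K0 uK] : exists2 K, 0 <= K & forall x, closure Omega x -> `|u 0 x| <= K.
  have : compact (u 0 @` closure Omega).
    apply: continuous_compact; last exact: closure_compact.
    exact: (sol_space_continuous hu).
  move=> /compact_bounded[C [_ uC]]; exists (`|C| + 1) => // x clx.
  by apply: uC; [rewrite (le_lt_trans (ler_norm _))// ltrDl|exists x].
have decay (sigma : R) : `|sigma| = 1 -> forall t x, 0 <= t -> closure Omega x ->
    sigma * u t x <= (K + 1) * expR (- lam * t) * psi x.
  move=> sigma1.
  apply: (@exp_comparison _ _ (closure Omega)
    [set x | Omega x /\ elliptic_at a1 a2 (G x)]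
    (fun t x => sigma * u t x) (fun t x => sigma * nonlocal_op Omega J G (u t) x)
    psi lam Lam) => //.
  - by move=> x [Ox _]; exact: subset_closure.
  - move=> t t0 e e0; have [d d0 ud] := solution_uniform_continuous hu t0 e0.
    exists d => // s s0 st x clx.
    by rewrite -mulrBr normrM sigma1 mul1r; exact: ud.
  - move=> t k t0 uk x clx; rewrite -subr_le0.
    apply: (closure_le0_ae (f := fun x => sigma * u t x - k * psi x)
      oO ae_ell) => //.
      apply/subspace_continuousP => y cly.
      have /subspace_continuousP/(_ y cly) cu := sol_space_continuous hu t0.
      apply: cvgB; apply: cvgM; do ?[exact: cvg_cst]; first exact: cu.
      by apply: cvg_within_filter; exact: cpsi.
    by move=> y Oy elly; rewrite subr_le0; apply: uk.
  - move=> x t [Ox ell] t0.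
    have du := solution_is_derive hu oO bO hJ a1_gt0 a12 Ox ell t0.
    exact: (is_deriveZ sigma du).
  - move=> x t B [Ox ell] t0 B0 uB.
    by apply: lepsi => //; exact: solution_admissible hu _ t0.
  - move=> x clx; rewrite (le_trans (ler_norm _))// normrM sigma1 mul1r.
    by rewrite (le_trans (uK _ clx))// ler_peMr// psi1.
exists ((K + 1) * `|A| + 1), lam; split=> //.
  by rewrite ltr_wpDl// mulr_ge0// addr_ge0.
move=> t x t0 clx.
apply: (@le_trans _ _ ((K + 1) * expR (- lam * t) * psi x)).
  have := decay 1 (normr1 _) t x t0 clx; have := decay (- 1) _ t x t0 clx.
  rewrite normrN1 mulN1r mul1r => /(_ erefl) ? ?.
  by rewrite ler_norml; apply/andP; split; lra.
have psi_le : psi x <= `|A|.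
  by rewrite (le_trans _ (ler_norm _))//; case/andP: (psiA x clx).
rewrite mulrAC ler_wpM2r ?expR_ge0//.
have : (K + 1) * psi x <= (K + 1) * `|A| by rewrite ler_wpM2l// addr_ge0.
lra.
Qed.

Theorem theorem2p9 (R : realType) (n : nat) (Omega : set 'rV[R]_n.+1)
    (J : 'rV[R]_n.+1 -> R) (G : 'rV[R]_n.+1 -> R -> R)
    (u0 : 'rV[R]_n.+1 -> R) (u : R -> 'rV[R]_n.+1 -> R)
    (hOmega : bounded_domain Omega)
    (hJ : kernel_assumptions J)
    (hG : nonlinearity_assumptions G)
    (hu0 : C0_closure Omega u0)
    (hu0_ge0 : forall x : 'rV[R]_n.+1, closure Omega x -> 0 <= u0 x)
    (hu : regular_solution Omega J G u0 u) :
  {uniform closure Omega, u t @[t --> +oo] --> (fun _ => 0)}.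
Proof.
have [oO _ _ bO] := hOmega.
have [C [lam [C0 lam0 uC]]] := solution_exp_decay oO bO hJ hG hu.
move=> P /uniform_nbhs[U [entU UP]].
have [e /= e0 eU] : exists2 e : R, 0 < e & forall y : R, `|y| < e -> U (0, y).
  move: entU; rewrite -entourage_ballE => -[e /= e0 eU]; exists e => // y ye.
  by apply: eU; rewrite /ball/= sub0r normrN.
rewrite /= nbhs_simpl/=; near=> t; apply: UP => x clx; apply: eU.
have t0 : 0 < t by near: t; exact: nbhs_pinfty_gt.
rewrite (le_lt_trans (uC t x (ltW t0) clx))// mulNr expRN ltr_pdivrMr ?expR_gt0//.
(* Beyond this time, [1 + lam * t <= expR (lam * t)] gives [C < e * expR (lam * t)]. *)
have : C / (e * lam) < t by near: t; apply: nbhs_pinfty_gt; exact: num_real.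
rewrite ltr_pdivrMr ?mulr_gt0// mulrC => Ct.
have := expR_ge1Dx (lam * t); rewrite -(ler_pM2l e0); lra.
Unshelve. all: by end_near. Qed.
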